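(* Let $\varphi$ be an endomorphism of a subshift $(X,\sigma)$. Then: (1) $\lim_{s\to\infty}P_L(\varphi^s)/s$ exists and equals $\sup_{s\ge1}P_L(\varphi^s)/s$; (2) $\lim_{s\to\infty}P_R(\varphi^s)/s$ exists and equals $\sup_{s\ge1}P_R(\varphi^s)/s$; (3) $\lim_{s\to\infty}Q_R(\varphi^s)/s$ exists and equals $\sup_{s\ge1}Q_R(\varphi^s)/s$; (4) $\lim_{s\to\infty}Q_L(\varphi^s)/s$ exists and equals $\sup_{s\ge1}Q_L(\varphi^s)/s$. (Limits and suprema are taken in $\mathbb R\cup\{\pm\infty\}$.)
   Context: **Subshifts.** An alphabet is a finite set with at least two elements. For an alphabet $A$, $A^{\mathbb Z}$ carries the product topology; the shift maps $(a_j)_j$ to $(a_{j+1})_j$. A subshift $(X,\sigma)$ over $A$ is a closed $X\subset A^{\mathbb Z}$ with $\sigma(X)=X$, $\sigma$ being the restricted shift; $L_k(X)$ is the set of words of length $k$ occurring in points of $X$. An endomorphism of $(X,\sigma)$ is a continuous map $\varphi:X\to X$ commuting with $\sigma$ (not assumed onto). **Type.** A local rule of neighborhood-size $N\ge 0$ on $X$ is a map $f:L_{N+1}(X)\to L_1(X)$ with $(f(a_j\dots a_{j+N}))_{j\in\mathbb Z}\in X$ for all $(a_j)\in X$. For $m,n\ge0$, $m+n=N$, $\varphi$ is of $(m,n)$-type given by $f$ if $\varphi((a_j)_j)=(f(a_{j-m}\dots a_{j+n}))_j$. Every endomorphism arises this way. **Degrees.** Let $f$ be a local rule of neighborhood-size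 $N$. It is $I$ left-redundant ($I\ge0$) if for all $(a_j),(b_j)\in X$, $a_j=b_j$ for all $j\ge0$ implies $f(a_{-I}\dots a_{-I+N})=f(b_{-I}\dots b_{-I+N})$; $I$ right-redundant if $a_j=b_j$ for all $j\le0$ implies $f(a_{I-N}\dots a_I)=f(b_{I-N}\dots b_I)$. It is strictly $I$ left-redundant if $I$ left-redundant but not $I+1$ left-redundant, strictly $\infty$ left-redundant if $I$ left-redundant for all $I\ge0$; similarly for right. It is $k$ right-mergible ($k\ge0$) if $a_j=b_j$ for $j\le 0$ and $f(a_{j-N}\dots a_j)=f(b_{j-N}\dots b_j)$ for $1\le j\le k+1$ imply $a_1=b_1$; $k$ left-mergible if $a_j=b_j$ for $j\ge0$ and $f(a_{-j}\dots a_{-j+N})=f(b_{-j}\dots b_{-j+N})$ for $1\le j\le k+1$ imply $a_{-1}=b_{-1}$. It is strictly $k$ right-mergible if $k\ge 0$ is the least integer for which it is $k$ right-mergible, strictly $\infty$ right-mergible if there is none; similarly for left. If $\varphi$ is of $(m,n)$-type given by $f$ which is strictly $I$ left-redundant, strictly $J$ right-redundant, strictly $k$ right-mergible and strictly $l$ left-mergible, then $P_L(\varphi)=I-m$, $P_R(\varphi)=J-n$ (values in $\mathbb Z\cup\{\infty\}$), and, if $X$ is infinite, $Q_R(\varphi)=n-k$, $Q_L(\varphi)=m-l$ (values in $\mathbb Z\cup\{-\infty\}$); if $X$ is finite, $Q_R(\varphi)=Q_L(\varphi)=\infty$. These are independent of the choice of $f$, $m$, $n$. Usual conventions for arithmetic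 and order with $\pm\infty$ are used; a sequence constantly equal to $\infty$ (resp. $-\infty$) has limit and supremum $\infty$ (resp. $-\infty$). *)

(* Defs.v *)
From HB Require Import structures.
From mathcomp Require Import all_boot all_order all_algebra.
From mathcomp Require Import all_classical all_reals all_analysis.

Set Implicit Arguments.
Unset Strict Implicit.
Unset Printing Implicit Defensive.

Import Order.TTheory GRing.Theory Num.Theory.

Local Open Scope classical_set_scope.
Local Open Scope ring_scope.

Definition full_shift (A : finType) : Type :=
  {ptws int -> discrete_topology A}.

HB.instance Definition _ (A : finType) := Topological.on (full_shift A).

Definition shift (A : finType) (a : full_shift A) : full_shift A :=
  fun j => a (j + 1).

Definition subshift (A : finType) (X : set (full_shift A)) : Prop :=
  closed X /\ @shift A @` X = X.

(* A self-map of X is represented by a map on the whole full shift; its values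
   outside X are never used (iterates stay in X because X is mapped to X). *)
Definition endomorphism (A : finType) (X : set (full_shift A))
    (phi : full_shift A -> full_shift A) : Prop :=
  [/\ {within X, continuous phi},
      set_fun X X phi &
      forall a, X a -> phi (shift a) = shift (phi a)].

(* The word a_i a_{i+1} ... a_{i+N}. *)
Definition word (A : finType) (N : nat) (a : full_shift A) (i : int) :
    N.+1.-tuple A :=
  [tuple a (i + (r : nat)%:Z) | r < N.+1].

Section Degrees.
Context (A : finType) (X : set (full_shift A)).

(* A map L_{N+1}(X) -> L_1(X) is represented by a map on all words of length
   N+1; every definition below evaluates it on words occurring in X only, and
   [local_rule] forces its values there to lie in L_1(X). *)
Section Rule.
Context (N : nat) (f : N.+1.-tuple A -> A).

Definition local_rule : Prop :=
  forall a, X a -> X (fun j => f (word N a j)).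

Definition left_redundant (I : nat) : Prop :=
  forall a b, X a -> X b -> (forall j, 0 <= j -> a j = b j) ->
    f (word N a (- I%:Z)) = f (word N b (- I%:Z)).

Definition right_redundant (I : nat) : Prop :=
  forall a b, X a -> X b -> (forall j, j <= 0 -> a j = b j) ->
    f (word N a (I%:Z - N%:Z)) = f (word N b (I%:Z - N%:Z)).

Definition right_mergible (k : nat) : Prop :=
  forall a b, X a -> X b -> (forall j, j <= 0 -> a j = b j) ->
    (forall j, 1 <= j <= k%:Z + 1 ->
       f (word N a (j - N%:Z)) = f (word N b (j - N%:Z))) ->
    a 1 = b 1.

Definition left_mergible (k : nat) : Prop :=
  forall a b, X a -> X b -> (forall j, 0 <= j -> a j = b j) ->
    (forall j, 1 <= j <= k%:Z + 1 -> f (word N a (- j)) = f (word N b (- j))) ->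
    a (- 1) = b (- 1).

End Rule.

(* In the next two definitions, [None] stands for infinity. *)
Definition strictly_redundant (P : nat -> Prop) (I : option nat) : Prop :=
  if I is Some i then P i /\ ~ P i.+1 else forall i, P i.

Definition strictly_mergible (P : nat -> Prop) (k : option nat) : Prop :=
  if k is Some i then P i /\ (forall j, P j -> (i <= j)%N)
  else forall i, ~ P i.

Definition ext (I : option nat) : \bar int :=
  if I is Some i then (i%:Z)%:E%E else +oo%E.

Definition of_type (phi : full_shift A -> full_shift A) (m n : nat)
    (f : (m + n).+1.-tuple A -> A) : Prop :=
  local_rule f /\
  forall a, X a -> forall j, phi a j = f (word (m + n) a (j - m%:Z)).

(* Each degree is the unique value given by the representations of phi by a
   local rule; the default value 0 of [xget] is never reached when phi is an
   endomorphism of the subshift X. *)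
Definition P_L (phi : full_shift A -> full_shift A) : \bar int :=
  xget 0%E [set v | exists m n (f : (m + n).+1.-tuple A -> A) I,
    [/\ of_type phi f, strictly_redundant (left_redundant f) I &
        v = (ext I - (m%:Z)%:E)%E]].

Definition P_R (phi : full_shift A -> full_shift A) : \bar int :=
  xget 0%E [set v | exists m n (f : (m + n).+1.-tuple A -> A) J,
    [/\ of_type phi f, strictly_redundant (right_redundant f) J &
        v = (ext J - (n%:Z)%:E)%E]].

Definition Q_R (phi : full_shift A -> full_shift A) : \bar int :=
  if pselect (finite_set X) then +oo%E else
  xget 0%E [set v | exists m n (f : (m + n).+1.-tuple A -> A) k,
    [/\ of_type phi f, strictly_mergible (right_mergible f) k &
        v = ((n%:Z)%:E - ext k)%E]].

Definition Q_L (phi : full_shift A -> full_shift A) : \bar int :=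
  if pselect (finite_set X) then +oo%E else
  xget 0%E [set v | exists m n (f : (m + n).+1.-tuple A -> A) l,
    [/\ of_type phi f, strictly_mergible (left_mergible f) l &
        v = ((m%:Z)%:E - ext l)%E]].

End Degrees.

(* D(phi^s) / s for a degree D; only the values at s >= 1 are meaningful. *)
Definition rate (R : realType) (A : finType)
    (D : (full_shift A -> full_shift A) -> \bar int)
    (phi : full_shift A -> full_shift A) (s : nat) : \bar R :=
  (er_map intr (D (iter s phi)) / (s%:R)%:E)%E.

(* Main.v *)
Require Import Defs.
From HB Require Import structures.
From mathcomp Require Import all_boot all_order all_algebra.
From mathcomp Require Import all_classical all_reals all_analysis.
From mathcomp Require Import zify lra ring.

Set Implicit Arguments.
Unset Strict Implicit.

Import Order.TTheory GRing.Theory Num.Theory.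
Import numFieldNormedType.Exports.

Local Open Scope classical_set_scope.
Local Open Scope ring_scope.

(** The idea is that each degree is the largest integer with an intrinsic
    property of the map, one that mentions neither a local rule nor a type, and
    that these properties add up under composition; the theorem is then
    Fekete's lemma for superadditive sequences.

    Fix a direction [e] in {1, -1} and say that [a] and [b] agree from [i] on if
    they have the same symbols at all positions [e * k] with [k >= i].  For
    [e = 1] these are right rays and give P_L and Q_L; for [e = -1] they are
    left rays and give P_R and Q_R.
    - P is the largest [p] such that agreement of [a] and [b] from [i] on forces
      agreement of [g a] and [g b] from [i - p] on ([redundant_by_agree]).
      Chaining this for two maps gives P(g o h) >= P(g) + P(h).
    - Q is the largest [q] such that, for points [a] and [b] that agree on some
      ray, agreement of [g a] and [g b] from [r] on forces agreement of [a] and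
      [b] from [r - q] on ([mergible_by_agree]).  Chaining this gives
      Q(g o h) >= Q(g) + Q(h).

    Two facts need compactness, both through [finite_window].  Every
    endomorphism is a sliding block code, so that it has local rules at all
    ([sliding_block_of_type]).  And a subshift in which every ray determines the
    next symbol is finite ([determined_finite]): this is why, over an infinite
    X, a rule of type (m, n) never gives a Q beyond n (resp. m), so that the
    least admissible k >= 0 really locates the maximum.

    Infinite values fit in Fekete's lemma as follows.  A value of P is never
    -oo, and a value +oo is absorbed by superadditivity.  For Q over an infinite
    X the value +oo does not occur, and Q(phi) = -oo forces Q(phi^s) = -oo for
    all s >= 1, because agreement of phi-images passes to phi^s-images with a
    bounded loss ([mergible_by_right]). *)

(** * Sliding block codes and compactness *)

Section Symbolic.
Context {A : finType} (X : set (full_shift A)).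
Implicit Types (a b : full_shift A) (g h : full_shift A -> full_shift A).

Definition translate (t : int) a : full_shift A := fun j => a (j + t).

(** The combinatorial content of being an endomorphism.  Unlike continuity on X,
    a finite window is visibly stable under composition and can be applied to
    rays. *)
Definition sliding_block g : Prop :=
  [/\ forall a, X a -> X (g a),
      forall a t, X a -> g (translate t a) = translate t (g a) &
      exists r : nat, forall a b, X a -> X b ->
        (forall j, `|j| <= r%:Z -> a j = b j) -> g a 0 = g b 0].

Lemma near_coordinate a (j : int) : \forall b \near a, b j = a j.
Proof.
have := @proj_continuous int (fun=> discrete_topology A) j a.
by move=> /(_ [set x | x = a j]); apply; exact: discrete_set1.
Qed.

Lemma compact_full_shift : compact [set: full_shift A].
Proof.
have fA : finite_set [set: discrete_topology A] by exact: (@finite_finset A).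
have := @tychonoff int (fun=> discrete_topology A) (fun=> setT)
  (fun=> finite_compact fA).
by congr (compact _); apply/seteqP; split.
Qed.

(** If the symbols at positions in J determine a locally constant f on X, then
    finitely many of them do.  This is compactness of X x X: a pair with
    f a <> f b differs at some position of J, and a whole neighborhood of the
    pair differs there too. *)
Lemma finite_window (J : set int) (f : full_shift A -> A) :
    closed X ->
    (forall a, X a -> \forall b \near a, X b -> f b = f a) ->
    (forall a b, X a -> X b -> (forall j, J j -> a j = b j) -> f a = f b) ->
  exists r : nat, forall a b, X a -> X b ->
    (forall j, J j -> `|j| <= r%:Z -> a j = b j) -> f a = f b.
Proof.
move=> cX lf fJ.
have cptX : compact X.
  by apply: (subclosed_compact cX compact_full_shift).
have /compact_near_coveringP := compact_setX cptX cptX.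
pose P (r : nat) (u : full_shift A * full_shift A) :=
  (X u.1 -> X u.2 ->
    (forall j, J j -> `|j| <= r%:Z -> u.1 j = u.2 j) -> f u.1 = f u.2).
move=> /(_ _ \oo P _) [].
  move=> [a b] [/= Xa Xb].
  have [ab|/existsNP[j /not_implyP[Jj abj]]] := pselect (forall j, J j -> a j = b j).
    (* The pair agrees on J: near it, f takes the common value twice. *)
    have fab := fJ _ _ Xa Xb ab.
    exists ([set u | X u.1 -> X u.2 -> f u.1 = f u.2], setT).
      split; last exact: filterT.
      exists ([set u | X u -> f u = f a], [set u | X u -> f u = f b]).
        by split; apply: lf.
      by move=> [u v] /= [fu fv] Xu Xv; rewrite fu // fv // fab.
    by move=> [u r] /= [uE _] Xu Xv _; exact: uE.
  (* The pair differs at j: near it, no pair agrees on a window reaching j. *)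
  exists ([set u | u.1 j = a j /\ u.2 j = b j], [set r | (`|j| <= r)%N]).
    split; last first.
      by exists `|j|%N.
    exists ([set u : full_shift A | u j = a j], [set u : full_shift A | u j = b j]).
      by split; exact: near_coordinate.
    by move=> [u v].
  move=> [[u v] r] /= [[uj vj] jr] _ _ uv; exfalso; apply: abj.
  rewrite /= in uj vj uv.
  by rewrite -uj -vj uv //; lia.
move=> r _ /(_ r (leqnn r)) Pr.
exists r => a b Xa Xb ab.
exact: (Pr (a, b) (conj Xa Xb)).
Qed.

Hypothesis subX : subshift X.

Lemma translate_shift t a : translate (t + 1) a = translate t (Defs.shift a).
Proof. by apply/funext => j; rewrite /translate /Defs.shift addrA. Qed.

Lemma translate0 a : translate 0 a = a.
Proof. by apply/funext => j; rewrite /translate addr0. Qed.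

Lemma subshift_translate t a : X a -> X (translate t a).
Proof.
have [_ sX] := subX.
elim/int_ind: t a => [|n IH|n IH] a Xa.
- by rewrite translate0.
- by rewrite -addn1 PoszD translate_shift; apply: IH; rewrite -sX; exists a.
- move: Xa; rewrite -{1}sX => -[b Xb <-].
  rewrite -translate_shift (_ : - n.+1%:Z + 1 = - n%:Z); last lia.
  exact: IH.
Qed.

(** The Curtis-Hedlund-Lyndon theorem: the symbol of [g a] at 0 is locally
    constant in [a], hence determined by a finite window. *)
Lemma endomorphism_sliding_block g : endomorphism X g -> sliding_block g.
Proof.
move=> [cg gX gS]; split=> //.
  move=> a t; elim/int_ind: t a => [|n IH|n IH] a Xa.
  - by rewrite !translate0.
  - rewrite -addn1 PoszD !translate_shift IH ?gS //.
    by rewrite -subX.2; exists a.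
  - move: Xa; rewrite -{1}subX.2 => -[b Xb <-].
    rewrite gS // -!translate_shift.
    by rewrite (_ : - n.+1%:Z + 1 = - n%:Z) ?IH //; lia.
have [r rP] : exists r : nat, forall a b, X a -> X b ->
    (forall j, setT j -> `|j| <= r%:Z -> a j = b j) -> g a 0 = g b 0.
  apply: (@finite_window setT (fun a => g a 0)) subX.1 _ _ => [a Xa|a b _ _ ab].
    have /subspace_continuousP/(_ a Xa) := cg.
    by move=> /(_ [set u | u 0 = g a 0] (near_coordinate (g a) 0)).
  by rewrite (_ : a = b) //; apply/funext => j; exact: ab.
by exists r => a b Xa Xb ab; apply: rP => // j _; exact: ab.
Qed.

Lemma sliding_block_at g : sliding_block g -> exists r : nat,
  forall a b i, X a -> X b ->
    (forall j, `|j - i| <= r%:Z -> a j = b j) -> g a i = g b i.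
Proof.
move=> [gX gt [r gr]]; exists r => a b i Xa Xb ab.
have := gr (translate i a) (translate i b).
rewrite !gt // /translate !add0r; apply; try exact: subshift_translate.
by move=> j ji; apply: ab; rewrite addrK.
Qed.

Lemma sliding_block_comp g h :
  sliding_block g -> sliding_block h -> sliding_block (g \o h).
Proof.
move=> Bg Bh; have [gX gt _] := Bg; have [hX ht _] := Bh.
have [r gr] := sliding_block_at Bg; have [s hs] := sliding_block_at Bh.
split=> [a Xa|a t Xa|]; first by apply/gX/hX.
- by rewrite /= ht // gt //; exact: hX.
- exists (r + s)%N => a b Xa Xb ab; apply: gr; try exact: hX.
  by move=> j jr; apply: hs => // k kj; apply: ab; lia.
Qed.

Lemma sliding_block_iter g s : sliding_block g -> sliding_block (iter s g).
Proof.
move=> Bg; elim: s => [|s IH]; last exact: (sliding_block_comp Bg IH).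
by split=> //; exists 0%N => a b _ _; apply.
Qed.

(** The rule reads the window [[-r, r]]; words that do not occur in X get an
    arbitrary symbol [c]. *)
Lemma sliding_block_of_type g : (0 < #|A|)%N -> sliding_block g ->
  exists m n (f : (m + n).+1.-tuple A -> A), of_type X g f.
Proof.
move=> /card_gt0P[c _] Bg; have [gX gt [r gr]] := Bg.
pose P (w : (r + r).+1.-tuple A) (x : A) :=
  (forall a, X a -> word (r + r) a (- r%:Z) = w -> g a 0 = x).
have [f fP] : {f & forall w, P w (f w)}.
  apply: choice => w.
  have [[a [Xa aw]]|nw] := pselect (exists a, X a /\ word (r + r) a (- r%:Z) = w).
    exists (g a 0) => b Xb bw; apply: gr => // j jr.
    have /(congr1 (fun t => tnth t (inord `|(j + r%:Z)%R|%N))) := etrans bw (esym aw).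
    rewrite !tnth_mktuple inordK; last lia.
    by rewrite (_ : - r%:Z + _ = j) //; lia.
  by exists c => a Xa aw; case: nw; exists a.
have fE a j : X a -> g a j = f (word (r + r) a (j - r%:Z)).
  move=> Xa; rewrite -(fP _ (translate j a) (subshift_translate j Xa) _).
    by rewrite gt // /translate add0r.
  by apply: eq_mktuple => k; rewrite /translate; congr a; lia.
exists r, r, f; split=> a Xa; last by move=> j; exact: fE.
rewrite (_ : (fun j => _) = translate r%:Z (g a)).
  by apply: subshift_translate; exact: gX.
by apply/funext => j; rewrite /translate fE // addrK.
Qed.

(** * Rays *)

Section Orientation.
Context (e : int) (e2 : e * e = 1).

(** Positions are written [e * k] so that both directions share their proofs. *)
Definition agree (i : int) a b := forall k, i <= k -> a (e * k) = b (e * k).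

(** By compactness a block of length r + 1 determines the symbol just behind it,
    hence the whole opposite ray.  So at any position at most |A|^(r+1) such rays
    occur.  Finitely many distinct points already differ on the opposite ray that
    starts far enough out, which bounds their number by |A|^(r+1). *)
Lemma determined_finite :
    (forall a b, X a -> X b -> agree 0 a b -> a (e * -1) = b (e * -1)) ->
  finite_set X.
Proof.
move=> det.
have [r rP] : exists r : nat, forall a b, X a -> X b ->
    (forall j, [set e * k | k in [set k | 0 <= k]] j -> `|j| <= r%:Z ->
      a j = b j) -> a (e * -1) = b (e * -1).
  apply: (@finite_window _ (fun a => a (e * -1))) subX.1 _ _ => [a _|a b Xa Xb ab].
    by apply: filterS (near_coordinate a (e * -1)) => b ->.
  by apply: det => // k k0; apply: ab; exists k.
have step a b i : X a -> X b ->
    (forall k : nat, (k <= r)%N -> a (e * (i + k%:Z)) = b (e * (i + k%:Z))) ->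
    forall j, j <= i + r%:Z -> a (e * j) = b (e * j).
  move=> Xa Xb ab.
  have low n k : (k <= r)%N ->
      a (e * (i - n%:Z + k%:Z)) = b (e * (i - n%:Z + k%:Z)).
    elim: n k => [|n IH] [|k] kr.
    - by rewrite subr0 ab.
    - by rewrite subr0 ab.
    - have := rP (translate (e * (i - n%:Z)) a) (translate (e * (i - n%:Z)) b).
      rewrite /translate -!mulrDr (_ : -1 + (i - n%:Z) = i - n.+1%:Z + 0); last lia.
      apply; try exact: subshift_translate.
      move=> _ [l /= l0 <-] lr; rewrite -!mulrDr addrC.
      have := IH `|l|%N; rewrite gez0_abs //; apply.
      have: `|e * (e * l)| <= r%:Z by rewrite !normrM in lr *; nia.
      by rewrite mulrA e2 mul1r; lia.
    - have := IH k (ltnW kr).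
      by rewrite (_ : i - n%:Z + k%:Z = i - n.+1%:Z + k.+1%:Z) //; lia.
  move=> j ji; have [le|gt] := leP j i.
    by have := low `|i - j|%N 0%N isT; rewrite (_ : i - _ + _ = j) //; lia.
  by have := ab `|j - i|%N; rewrite (_ : i + _ = j); [apply; lia | lia].
apply: contrapT => infX.
have /card_leP/unsquash y := (infiniteP X).1 infX.
pose x (k : nat) := set_val (y (SigSub (mem_set (I : [set: nat] k)))).
have xX k : X (x k) by exact: set_valP.
have xI : injective x by move=> k l /val_inj/(@inj _ _ _ y); rewrite !inE => /(_ I I)[].
(* One point more than there are blocks, and a position M0 by which all of
   them differ pairwise. *)
pose W := #|{ffun 'I_r.+1 -> A}|.
pose P (u : 'I_W.+1 * 'I_W.+1) (m : nat) := u.1 != u.2 ->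
  exists2 j : int, j <= m%:Z & x u.1 (e * j) <> x u.2 (e * j).
have [M MP] : {M & forall u, P u (M u)}.
  apply: choice => -[k l]; rewrite /P /=.
  have [<-|kl] := eqVneq k l; first by exists 0%N.
  have [j xj] : exists j, x k j <> x l j.
    apply/not_existsP => xkl; case/negP: kl; apply/eqP/val_inj/xI/funext => j.
    exact: contrapT (xkl j).
  exists `|(e * j)%R|%N => _; exists (e * j); first lia.
  by rewrite mulrA e2 mul1r.
pose M0 := \max_u M u.
pose F (k : 'I_W.+1) : {ffun 'I_r.+1 -> A} :=
  [ffun i : 'I_r.+1 => x k (e * (M0%:Z - r%:Z + (i : nat)%:Z))].
have FI : injective F.
  move=> k l Fkl; apply: contrapT => /eqP kl.
  have [j jM] := MP (k, l) kl; apply => /=.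
  apply: (step _ _ (M0%:Z - r%:Z)) => // [i ir|].
    by have /ffunP/(_ (inord i)) := Fkl; rewrite !ffunE inordK.
  rewrite subrK (le_trans jM) // lez_nat.
  exact: (leq_bigmax (k, l)).
by have := leq_card F FI; rewrite card_ord ltnn.
Qed.

Lemma translateE t a k : translate (e * t) a (e * k) = a (e * (k + t)).
Proof. by rewrite /translate mulrDr. Qed.

Lemma agree_translate i t a b :
  agree (i + t) a b -> agree i (translate (e * t) a) (translate (e * t) b).
Proof. by move=> ab k ik; rewrite !translateE; apply: ab; lia. Qed.

Lemma sliding_block_agree g : sliding_block g -> exists c : nat,
  forall a b i, X a -> X b -> agree i a b -> agree (i + c%:Z) (g a) (g b).
Proof.
move=> /sliding_block_at[r gr]; exists r => a b i Xa Xb ab k ik.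
apply: gr => // j jk.
have -> : j = e * (e * j) by rewrite mulrA e2 mul1r.
apply: ab; suff : `|e * j - k| <= r%:Z by lia.
rewrite (_ : e * j - k = e * (j - e * k)).
  by rewrite normrM (_ : `|e| = 1) ?mul1r //; nia.
by rewrite mulrBr mulrA e2 mul1r.
Qed.

(** Intrinsic form of [P(g) >= p], in direction [e]. *)
Definition redundant_by g (p : int) : Prop := forall a b, X a -> X b ->
  agree 0 a b -> g a (e * - p) = g b (e * - p).

Lemma redundant_by_agree g p : sliding_block g -> redundant_by g p ->
  forall a b i, X a -> X b -> agree i a b -> agree (i - p) (g a) (g b).
Proof.
move=> [_ gt _] gp a b i Xa Xb ab k ik.
have := gp (translate (e * (k + p)) a) (translate (e * (k + p)) b).
rewrite !gt // !translateE (_ : - p + (k + p) = k); last lia.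
apply; try exact: subshift_translate.
by apply: agree_translate => l lk; apply: ab; lia.
Qed.

Lemma redundant_by_le g p q : sliding_block g -> q <= p ->
  redundant_by g p -> redundant_by g q.
Proof.
move=> Bg qp gp a b Xa Xb ab.
by apply: (redundant_by_agree Bg gp Xa Xb ab); lia.
Qed.

Lemma redundant_by_comp g h p q : sliding_block g -> sliding_block h ->
  redundant_by g p -> redundant_by h q -> redundant_by (g \o h) (p + q).
Proof.
move=> Bg Bh gp hq a b Xa Xb ab; have [hX _ _] := Bh.
apply: (redundant_by_agree Bg gp (hX _ Xa) (hX _ Xb)
  (redundant_by_agree Bh hq Xa Xb ab)); lia.
Qed.

(** Intrinsic form of [Q(g) >= q], in direction [e]. *)
Definition mergible_by g (q : int) : Prop := forall a b, X a -> X b ->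
  agree 0 a b -> agree (q - 1) (g a) (g b) -> a (e * -1) = b (e * -1).

(** Merging recovers one symbol of a and b at a time; starting from the ray where
    they agree, it can be repeated as long as it needs images at positions from
    [r] on only. *)
Lemma mergible_by_agree g q : sliding_block g -> mergible_by g q ->
  forall a b i r, X a -> X b -> agree i a b -> agree r (g a) (g b) ->
  agree (r - q) a b.
Proof.
move=> [_ gt _] gq a b i r Xa Xb ab gab.
have H n : agree (i - n%:Z) a b \/ agree (r - q) a b.
  elim: n => [|n [IH|]]; [by left; rewrite subr0 | | by right].
  have [le|gt1] := leP (i - n%:Z) (r - q).
    by right => k rk; apply: IH; lia.
  left => k ik; have [le|] := leP (i - n%:Z) k; first exact: IH.
  move=> lt; have {ik lt} -> : k = - 1 + (i - n%:Z) by lia.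
  have := gq (translate (e * (i - n%:Z)) a) (translate (e * (i - n%:Z)) b).
  rewrite !gt // !translateE; apply; try exact: subshift_translate.
    by apply: agree_translate; rewrite add0r.
  by apply: agree_translate => l lr; apply: gab; lia.
have [ab'|//] := H `|(i - (r - q))%R|%N.
by move=> k rk; apply: ab'; lia.
Qed.

Lemma mergible_by_le g p q : q <= p -> mergible_by g p -> mergible_by g q.
Proof.
by move=> qp gp a b Xa Xb ab gab; apply: gp => // k kp; apply: gab; lia.
Qed.

Lemma mergible_by_comp g h p q : sliding_block g -> sliding_block h ->
  mergible_by g p -> mergible_by h q -> mergible_by (g \o h) (p + q).
Proof.
move=> Bg Bh gp hq a b Xa Xb ab gab; have [hX _ _] := Bh.
have [c hc] := sliding_block_agree Bh.
apply: hq => // k kq.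
apply: (mergible_by_agree Bg gp (hX _ Xa) (hX _ Xb) (hc _ _ _ Xa Xb ab) gab).
by lia.
Qed.

(** If [h] reads at most [c] positions away, agreement of [g a] and [g b] from
    [i - c] on gives agreement of their images under [h] from [i] on; so
    [p = q - c] works. *)
Lemma mergible_by_right g h q : sliding_block g -> sliding_block h ->
  mergible_by (h \o g) q -> exists p, mergible_by g p.
Proof.
move=> [gX _ _] /sliding_block_agree[c hc] hq.
exists (q - c%:Z) => a b Xa Xb ab gab; apply: hq => // k kq.
apply: (hc _ _ _ (gX _ Xa) (gX _ Xb) gab); lia.
Qed.

(** If agreement of [a] and [b] alone yields the agreement of images that merging
    asks for, then merging says that rays determine the next symbol. *)
Lemma mergible_by_infinite g c : infinite_set X ->
    (forall a b i, X a -> X b -> agree i a b -> agree (i + c) (g a) (g b)) ->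
  ~ mergible_by g (c + 1).
Proof.
move=> infX gc gm; apply/infX/determined_finite => a b Xa Xb ab.
by apply: gm => //; rewrite addrK -[c]add0r; exact: gc.
Qed.

End Orientation.
End Symbolic.

(** * Fekete's lemma with infinite values *)

(** For a downward closed S this says that v is the supremum of S among the
    extended integers. *)
Definition is_top (S : int -> Prop) (v : \bar int) : Prop :=
  match v with
  | p%:E%E => S p /\ ~ S (p + 1)
  | +oo%E => forall p, S p
  | -oo%E => forall p, ~ S p
  end.

Section Fekete.
Context {R : realType} (S : nat -> int -> Prop) (D : nat -> \bar int).
Hypotheses (topS : forall s, is_top (S s) (D s))
  (leS : forall s p q, q <= p -> S s p -> S s q)
  (S00 : S 0 0)
  (addS : forall s t p q, S s p -> S t q -> S (s + t) (p + q)).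

Let u (s : nat) : \bar R := (er_map intr (D s) / (s%:R)%:E)%E.

Let uE s : (0 < s)%N -> u s = (er_map intr (D s) * ((s%:R)^-1)%:E)%E.
Proof. by move=> s0; rewrite /u inver pnatr_eq0 gtn_eqF. Qed.

Lemma le_rate s p : (0 < s)%N -> S s p -> ((p%:~R / s%:R)%:E <= u s)%E.
Proof.
move=> s0 Sp; rewrite uE //; have s1 : (0 : R) < s%:R^-1 by rewrite invr_gt0 ltr0n.
have := topS s; case: (D s) => [q [_ Sq]|_|/(_ p)] //=.
- rewrite -EFinM lee_fin ler_pM2r // ler_int leNgt; apply/negP => qp.
  by apply: Sq; apply: leS Sp; lia.
- by rewrite gt0_mulye ?leey.
Qed.

Lemma lt_rateP s (c : R) : (0 < s)%N -> (c%:E < u s)%E ->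
  exists2 p, S s p & c < p%:~R / s%:R.
Proof.
move=> s0; rewrite uE //; have s1 : (0 : R) < s%:R^-1 by rewrite invr_gt0 ltr0n.
have := topS s; case: (D s) => [q [Sq _]|Sall|_] /=.
- by rewrite -EFinM lte_fin; exists q.
- move=> _; exists (Num.floor (c * s%:R) + 1) => //.
  by rewrite ltr_pdivlMr ?ltr0n // floorD1_gt.
- by rewrite gt0_mulNye.
Qed.

Let mulS s p k : S s p -> S (k * s) (k%:Z * p).
Proof.
move=> Sp; elim: k => [|k IH]; first by rewrite mul0n mul0r.
by rewrite mulSn -[k.+1%:Z]/(1 + k%:Z) mulrDl mul1r; exact: addS.
Qed.

(** Write t = k s + r with r < s.  Superadditivity gives a value of at least
    k p + r p0 at t, which is t p / s up to an error K that does not depend on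
    t; so it exceeds c t once t > K / (p / s - c). *)
Lemma rate_eventually p0 s (c : R) : S 1 p0 -> (0 < s)%N -> (c%:E < u s)%E ->
  \forall t \near \oo, (c%:E < u t)%E.
Proof.
move=> S1 s0 /(lt_rateP s0)[p Sp cp].
set x := p%:~R / s%:R in cp.
pose K : R := s%:R * `|p0%:~R - x|.
near=> t.
have t0 : (0 < t)%N by near: t; exists 1%N.
have St : S t ((t %/ s)%N%:Z * p + (t %% s)%N%:Z * p0).
  rewrite [X in S X](divn_eq t s); apply: addS; first exact: mulS.
  by have := mulS (t %% s) S1; rewrite muln1.
apply: lt_le_trans (le_rate t0 St).
rewrite lte_fin ltr_pdivlMr ?ltr0n // intrD !intrM -2!pmulrn.
have tK : K / (x - c) < t%:R by near: t; exact: nbhs_infty_gtr.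
rewrite ltr_pdivrMr ?subr_gt0 // in tK.
have px : p%:~R = x * s%:R by rewrite /x divfK // pnatr_eq0 -lt0n.
have te : t%:R = (t %/ s)%:R * s%:R + (t %% s)%:R :> R.
  by rewrite -natrM -natrD -divn_eq.
have rs : (t %% s)%:R <= s%:R :> R by rewrite ler_nat ltnW // ltn_pmod.
have r0 : 0 <= (t %% s)%:R :> R by [].
have Kr : (t %% s)%:R * (p0%:~R - x) >= - K.
  apply: (@le_trans _ _ (- `|(t %% s)%:R * (p0%:~R - x)|)).
    by rewrite lerN2 normrM (ger0_norm r0) /K ler_wpM2r.
  exact: lerNnormlW.
rewrite px te; rewrite te in tK.
have -> : (t %/ s)%:R * (x * s%:R) + (t %% s)%:R * p0%:~R =
  ((t %/ s)%:R * s%:R + (t %% s)%:R) * x + (t %% s)%:R * (p0%:~R - x) by ring.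
lra.
Unshelve. all: by end_near. Qed.

(** In the first case superadditivity keeps every rate above -oo and the previous
    lemma bounds the rates from below; in the second they are constantly -oo. *)
Theorem fekete : (exists p, S 1 p) \/ (forall s, (0 < s)%N -> forall p, ~ S s p) ->
  u @ \oo --> ereal_sup [set u s | s in [set s | (1 <= s)%N]].
Proof.
set L := ereal_sup _.
have uL s : (0 < s)%N -> (u s <= L)%E.
  by move=> s0; apply: ereal_sup_ubound; exists s.
case=> [[p0 S1]|nS]; last first.
  have uNy s : (0 < s)%N -> u s = -oo%E.
    move=> s0; rewrite uE //; have := topS s.
    case: (D s) => [q [Sq _]|Sall|_] /=.
    - by case: (nS s s0 q Sq).
    - by case: (nS s s0 0 (Sall 0)).
    - by rewrite gt0_mulNye // lte_fin invr_gt0 ltr0n.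
  have -> : L = -oo%E.
    by apply/eqP; rewrite -leeNy_eq; apply: ge_ereal_sup => _ [s s0 <-]; rewrite uNy.
  by apply: cvg_near_cst; exists 1%N => // s s0; exact: uNy.
have near_lt (c : R) : (c%:E < L)%E -> \forall t \near \oo, (c%:E < u t)%E.
  by move=> /ereal_sup_gt[_ [s s0 <-]]; exact: (rate_eventually S1).
have L1 : ((p0%:~R / 1%:R)%:E <= L)%E := le_trans (@le_rate 1 p0 isT S1) (uL 1%N isT).
move: near_lt uL L1; case: L => [l| |] near_lt uL L1.
- have ul : \forall t \near \oo, (u t <= l%:E)%E by exists 1%N.
  apply/fine_cvgP; split.
    have l1 : ((l - 1)%:E < l%:E)%E by rewrite lte_fin; lra.
    near=> t; have : ((l - 1)%:E < u t)%E by near: t; exact: near_lt.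
    have : (u t <= l%:E)%E by near: t.
    by case: (u t).
  apply/cvgrPdist_lt => eps eps0.
  have l1 : ((l - eps)%:E < l%:E)%E by rewrite lte_fin; lra.
  near=> t; have : ((l - eps)%:E < u t)%E by near: t; exact: near_lt.
  have : (u t <= l%:E)%E by near: t.
  rewrite /=; case: (u t) => [v| |] //=; rewrite lee_fin lte_fin => vl lv.
  rewrite ger0_norm; lra.
- by apply/cvgeyPgt => c; apply: near_lt; rewrite ltry.
- by move: L1; rewrite leeNy_eq.
Unshelve. all: by end_near. Qed.

End Fekete.

(** * From local rules to intrinsic degrees *)

Lemma strictly_redundant_ex (P : nat -> Prop) : P 0%N ->
  exists I, strictly_redundant P I.
Proof.
move=> P0; have [Pall|/existsNP nP] := pselect (forall i, P i); first by exists None.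
suff [i] : exists i, P i /\ ~ P i.+1 by exists (Some i).
apply: contrapT => /forallNP H; case: nP => n; apply.
elim: n => // n IH; apply: contrapT => nS; exact: (H n).
Qed.

Lemma strictly_mergible_ex (P : nat -> Prop) : exists k, strictly_mergible P k.
Proof.
have [[n Pn]|/forallNP nP] := pselect (exists n, P n); last by exists None.
have ex : exists n, `[< P n >] by exists n; apply/asboolP.
exists (Some (ex_minn ex)); case: ex_minnP => k /asboolP Pk kmin.
by split=> // j Pj; apply: kmin; apply/asboolP.
Qed.

Section TopOfStrict.
Context (S : int -> Prop) (leS : forall p q, q <= p -> S p -> S q).

Lemma is_top_redundant (P : nat -> Prop) (m : nat) I :
    (forall i : nat, P i <-> S (i%:Z - m%:Z)) -> strictly_redundant P I ->
  is_top S (ext I - (m%:Z)%:E)%E.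
Proof.
move=> PS; case: I => [i [/PS Pi nPi]|Pall] /=.
  split=> // Si; apply/nPi/PS.
  by rewrite (_ : i.+1%:Z - m%:Z = i%:Z - m%:Z + 1) //; lia.
by move=> p; have /PS := Pall (`|p| + m)%N; apply: leS; lia.
Qed.

(** The least k corresponds to the largest n - k, except that k = 0 is least for
    a trivial reason; there the bound [~ S (n + 1)] steps in. *)
Lemma is_top_mergible (P : nat -> Prop) (n : nat) k :
    (forall i : nat, P i <-> S (n%:Z - i%:Z)) -> ~ S (n%:Z + 1) ->
  strictly_mergible P k -> is_top S ((n%:Z)%:E - ext k)%E.
Proof.
move=> PS nS; case: k => [k [/PS Pk kmin]|nP] /=.
  split=> // Sk; case: k => [|k] in Pk kmin Sk.
    by apply: nS; rewrite subr0 in Sk.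
  suff /kmin : P k by rewrite ltnn.
  by apply/PS; rewrite (_ : _ - k%:Z = n%:Z - k.+1%:Z + 1) //; lia.
move=> p Sp; apply: (nP `|(n%:Z - p)%R|%N); apply/PS; apply: leS Sp; lia.
Qed.

End TopOfStrict.

Section Degrees.
Context {A : finType} (A0 : (0 < #|A|)%N) (X : set (full_shift A)).
Hypothesis subX : subshift X.
Implicit Types (a b : full_shift A) (g : full_shift A -> full_shift A).

Lemma agree1 i a b : agree 1 i a b <-> forall j, i <= j -> a j = b j.
Proof. by split=> ab k ik; have := ab k ik; rewrite mul1r. Qed.

Lemma agreeN1 i a b : agree (-1) i a b <-> forall j, j <= - i -> a j = b j.
Proof.
split=> ab k ik; last by rewrite mulN1r ab //; lia.
by have := ab (- k); rewrite mulN1r opprK; apply; lia.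
Qed.

Lemma word_eq N a b i : (forall j, i <= j <= i + N%:Z -> a j = b j) ->
  word N a i = word N b i.
Proof.
by move=> ab; apply: eq_mktuple => k; apply: ab; have := ltn_ord k; lia.
Qed.

Section OfType.
Context (g : full_shift A -> full_shift A) (m n : nat)
  (f : (m + n).+1.-tuple A -> A) (Tf : of_type X g f).

Lemma of_typeE a j : X a -> f (word (m + n) a j) = g a (j + m%:Z).
Proof. by move=> Xa; rewrite Tf.2 // addrK. Qed.

Lemma of_type_eq a b i : X a -> X b ->
  (forall j, i - m%:Z <= j <= i + n%:Z -> a j = b j) -> g a i = g b i.
Proof.
move=> Xa Xb ab; rewrite !Tf.2 //; congr f; apply: word_eq => j jP.
by apply: ab; lia.
Qed.

Lemma left_redundantE (i : nat) :
  left_redundant X f i <-> redundant_by X 1 g (i%:Z - m%:Z).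
Proof.
split=> H a b Xa Xb; have := H a b Xa Xb; rewrite agree1 !of_typeE // mul1r;
  by rewrite (_ : - i%:Z + m%:Z = - (i%:Z - m%:Z)) //; lia.
Qed.

Lemma right_redundantE (i : nat) :
  right_redundant X f i <-> redundant_by X (-1) g (i%:Z - n%:Z).
Proof.
split=> H a b Xa Xb; have := H a b Xa Xb; rewrite agreeN1 oppr0 !of_typeE //;
  by rewrite mulrNN mul1r (_ : _ + m%:Z = i%:Z - n%:Z) //; lia.
Qed.

(** The rule is only compared on k + 1 positions, but the images agree
    at all earlier ones since the windows lie where the two points agree. *)
Lemma right_mergibleE (k : nat) :
  right_mergible X f k <-> mergible_by X (-1) g (n%:Z - k%:Z).
Proof.
split=> H a b Xa Xb.
  move=> /agreeN1; rewrite oppr0 => ab /agreeN1 gab; rewrite mulrNN mul1r.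
  by apply: H => // j jP; rewrite !of_typeE //; apply: gab; lia.
move=> ab fab; have := H a b Xa Xb; rewrite mulrNN mul1r; apply; apply/agreeN1.
  by rewrite oppr0.
move=> j jP; have [le|lt] := leP (1 - n%:Z) j; last first.
  by apply: of_type_eq => // l lP; apply: ab; lia.
have := fab (j + n%:Z); rewrite !of_typeE //.
by rewrite (_ : _ + m%:Z = j); [apply; lia | lia].
Qed.

Lemma left_mergibleE (k : nat) :
  left_mergible X f k <-> mergible_by X 1 g (m%:Z - k%:Z).
Proof.
split=> H a b Xa Xb.
  move=> /agree1 ab /agree1 gab; rewrite mul1r.
  by apply: H => // j jP; rewrite !of_typeE //; apply: gab; lia.
move=> ab fab; have := H a b Xa Xb; rewrite mul1r; apply; apply/agree1 => // j jP.
have [le|lt] := leP j (m%:Z - 1); last first.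
  by apply: of_type_eq => // l lP; apply: ab; lia.
have := fab (m%:Z - j); rewrite !of_typeE //.
by rewrite (_ : _ + m%:Z = j); [apply; lia | lia].
Qed.

Lemma of_type_agree1 a b i : X a -> X b -> agree 1 i a b ->
  agree 1 (i + m%:Z) (g a) (g b).
Proof.
move=> Xa Xb /agree1 ab; apply/agree1 => j ij.
by apply: of_type_eq => // l lP; apply: ab; lia.
Qed.

Lemma of_type_agreeN1 a b i : X a -> X b -> agree (-1) i a b ->
  agree (-1) (i + n%:Z) (g a) (g b).
Proof.
move=> Xa Xb /agreeN1 ab; apply/agreeN1 => j ij.
by apply: of_type_eq => // l lP; apply: ab; lia.
Qed.

Lemma left_redundant0 : left_redundant X f 0.
Proof. by move=> a b _ _ ab; congr f; apply: word_eq => j jP; apply: ab; lia. Qed.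

Lemma right_redundant0 : right_redundant X f 0.
Proof. by move=> a b _ _ ab; congr f; apply: word_eq => j jP; apply: ab; lia. Qed.

End OfType.

(** Every representation of [g] gives the supremum, in particular the one that is
    picked. *)
Lemma is_top_P_L g : sliding_block X g -> is_top (redundant_by X 1 g) (P_L X g).
Proof.
move=> Bg; rewrite /P_L; set V := [set v | _].
have [|m [n [f [I [Tf sI ->]]]]] := @xgetPex _ 0%E V.
  have [m [n [f Tf]]] := sliding_block_of_type subX A0 Bg.
  have [I sI] := strictly_redundant_ex (@left_redundant0 _ _ f).
  by exists (ext I - (m%:Z)%:E)%E, m, n, f, I.
apply: (is_top_redundant _ (left_redundantE Tf) sI).
by move=> p q; exact: redundant_by_le.
Qed.

Lemma is_top_P_R g : sliding_block X g -> is_top (redundant_by X (-1) g) (P_R X g).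
Proof.
move=> Bg; rewrite /P_R; set V := [set v | _].
have [|m [n [f [I [Tf sI ->]]]]] := @xgetPex _ 0%E V.
  have [m [n [f Tf]]] := sliding_block_of_type subX A0 Bg.
  have [I sI] := strictly_redundant_ex (@right_redundant0 _ _ f).
  by exists (ext I - (n%:Z)%:E)%E, m, n, f, I.
apply: (is_top_redundant _ (right_redundantE Tf) sI).
by move=> p q; exact: redundant_by_le.
Qed.

Lemma is_top_Q_R g : infinite_set X -> sliding_block X g ->
  is_top (mergible_by X (-1) g) (Q_R X g).
Proof.
move=> infX Bg; rewrite /Q_R; case: pselect => //= _; set V := [set v | _].
have [|m [n [f [k [Tf sk ->]]]]] := @xgetPex _ 0%E V.
  have [m [n [f Tf]]] := sliding_block_of_type subX A0 Bg.
  have [k sk] := strictly_mergible_ex (right_mergible X f).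
  by exists ((n%:Z)%:E - ext k)%E, m, n, f, k.
apply: (is_top_mergible _ (right_mergibleE Tf) _ sk).
  by move=> p q; exact: mergible_by_le.
by apply: mergible_by_infinite => // a b i; exact: (of_type_agreeN1 Tf).
Qed.

Lemma is_top_Q_L g : infinite_set X -> sliding_block X g ->
  is_top (mergible_by X 1 g) (Q_L X g).
Proof.
move=> infX Bg; rewrite /Q_L; case: pselect => //= _; set V := [set v | _].
have [|m [n [f [k [Tf sk ->]]]]] := @xgetPex _ 0%E V.
  have [m [n [f Tf]]] := sliding_block_of_type subX A0 Bg.
  have [k sk] := strictly_mergible_ex (left_mergible X f).
  by exists ((m%:Z)%:E - ext k)%E, m, n, f, k.
apply: (is_top_mergible _ (left_mergibleE Tf) _ sk).
  by move=> p q; exact: mergible_by_le.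
by apply: mergible_by_infinite => // a b i; exact: (of_type_agree1 Tf).
Qed.

End Degrees.

(** * Superadditivity along the iterates *)

Section Rates.
Context (R : realType) {A : finType} (X : set (full_shift A)).
Hypothesis subX : subshift X.
Context (phi : full_shift A -> full_shift A) (Bphi : sliding_block X phi).

Let Biter s : sliding_block X (iter s phi) := sliding_block_iter subX s Bphi.
Let iter_add s t : iter (s + t) phi = iter s phi \o iter t phi.
Proof. by apply/funext => a; rewrite iterD. Qed.

Lemma redundant_rate e D : e * e = 1 ->
    (forall g, sliding_block X g -> is_top (redundant_by X e g) (D g)) ->
  rate R D phi @ \oo --> ereal_sup [set rate R D phi s | s in [set s | (1 <= s)%N]].
Proof.
move=> e2 topD.
apply: (@fekete R (fun s => redundant_by X e (iter s phi)) (fun s => D (iter s phi))).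
- by move=> s; exact: topD.
- by move=> s p q; exact: redundant_by_le.
- by move=> a b _ _; apply; rewrite oppr0.
- by move=> s t p q Sp Sq; rewrite iter_add; exact: redundant_by_comp.
- left; have [c cP] := sliding_block_agree subX e2 Bphi.
  by exists (- c%:Z) => a b Xa Xb ab; rewrite opprK; apply: cP ab _ _ => //; lia.
Qed.

Lemma mergible_rate e D : e * e = 1 ->
    (infinite_set X ->
      forall g, sliding_block X g -> is_top (mergible_by X e g) (D g)) ->
    (finite_set X -> forall g, D g = +oo%E) ->
  rate R D phi @ \oo --> ereal_sup [set rate R D phi s | s in [set s | (1 <= s)%N]].
Proof.
move=> e2 topD finD; have [finX|infX] := pselect (finite_set X).
  (* Over a finite X the degree is +oo by convention: every integer is below it. *)
  apply: (@fekete R (fun _ _ => True) (fun s => D (iter s phi))) => //.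
    by move=> s; rewrite finD.
  by left; exists 0.
apply: (@fekete R (fun s => mergible_by X e (iter s phi)) (fun s => D (iter s phi))).
- by move=> s; exact: topD.
- by move=> s p q; exact: mergible_by_le.
- by move=> a b _ _ _; apply.
- by move=> s t p q Sp Sq; rewrite iter_add; exact: mergible_by_comp.
- have [?|n1] := pselect (exists p, mergible_by X e (iter 1 phi) p); first by left.
  right=> -[//|s] _ p; rewrite -addn1 iter_add => Sp; apply: n1.
  exact: mergible_by_right Sp.
Qed.

End Rates.

Unset Implicit Arguments.
Set Strict Implicit.

Theorem theorem9p2 (R : realType) (A : finType) (hA : (1 < #|A|)%N)
    (X : set (full_shift A)) (hX : subshift X)
    (phi : full_shift A -> full_shift A) (hphi : endomorphism X phi) :
  [/\ rate R (P_L X) phi @ \oo -->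
        ereal_sup [set rate R (P_L X) phi s | s in [set s | (1 <= s)%N]],
      rate R (P_R X) phi @ \oo -->
        ereal_sup [set rate R (P_R X) phi s | s in [set s | (1 <= s)%N]],
      rate R (Q_R X) phi @ \oo -->
        ereal_sup [set rate R (Q_R X) phi s | s in [set s | (1 <= s)%N]] &
      rate R (Q_L X) phi @ \oo -->
        ereal_sup [set rate R (Q_L X) phi s | s in [set s | (1 <= s)%N]]].
Proof.
have A0 : (0 < #|A|)%N := ltnW hA.
have Bphi := endomorphism_sliding_block hX hphi.
split.
- by apply: (@redundant_rate R A X hX phi Bphi 1) => // g; exact: is_top_P_L.
- by apply: (@redundant_rate R A X hX phi Bphi (-1)) => // g; exact: is_top_P_R.
- apply: (@mergible_rate R A X hX phi Bphi (-1)) => // [iX g|fX g].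
    exact: is_top_Q_R.
  by rewrite /Q_R; case: pselect.
- apply: (@mergible_rate R A X hX phi Bphi 1) => // [iX g|fX g].
    exact: is_top_Q_L.
  by rewrite /Q_L; case: pselect.
Qed.
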